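(* Let $k$ be an algebraically closed field of characteristic $0$, $R=k\langle x,y\rangle/(xy-yx-y^2)$, and let $\rho_n:R\to\mathrm{End}(k^n)$ be an $n$-dimensional representation of $R$. Then the matrix $Y=\rho_n(y)$ is nilpotent. *)

(* Defs.v *)
From HB Require Import structures.
From mathcomp Require Import all_boot all_algebra.
From mathcomp Require Import boolp.
From mathcomp Require Export monalg.

Set Implicit Arguments.
Unset Strict Implicit.
Unset Printing Implicit Defensive.

Import GRing.Theory Quotient.

Local Open Scope ring_scope.
Local Open Scope quotient_scope.

Section TwoSidedIdeal.
Variables (A : pzRingType) (r : A).

Definition two_sided_ideal : {pred A} :=
  fun u => `[< exists s : seq (A * A), u = \sum_(p <- s) p.1 * r * p.2 >].

Lemma two_sided_idealP (u : A) :
  reflect (exists s : seq (A * A), u = \sum_(p <- s) p.1 * r * p.2)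
          (u \in two_sided_ideal).
Proof. exact: asboolP. Qed.

Lemma two_sided_ideal_gen : r \in two_sided_ideal.
Proof.
by apply/two_sided_idealP; exists [:: (1, 1)]; rewrite big_seq1 mul1r mulr1.
Qed.

Lemma two_sided_idealMl (a u : A) :
  u \in two_sided_ideal -> a * u \in two_sided_ideal.
Proof.
case/two_sided_idealP=> s ->; apply/two_sided_idealP.
exists [seq (a * p.1, p.2) | p <- s].
by rewrite big_map mulr_sumr; apply: eq_bigr => p _; rewrite !mulrA.
Qed.

Lemma two_sided_idealMr (a u : A) :
  u \in two_sided_ideal -> u * a \in two_sided_ideal.
Proof.
case/two_sided_idealP=> s ->; apply/two_sided_idealP.
exists [seq (p.1, p.2 * a) | p <- s].
by rewrite big_map mulr_suml; apply: eq_bigr => p _; rewrite !mulrA.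
Qed.

Lemma two_sided_ideal_zmod_closed : zmod_closed two_sided_ideal.
Proof.
split=> [|u v]; first by apply/two_sided_idealP; exists [::]; rewrite big_nil.
move=> /two_sided_idealP[s ->] /two_sided_idealP[t ->].
apply/two_sided_idealP; exists (s ++ [seq (- p.1, p.2) | p <- t]).
rewrite big_cat big_map -sumrN; congr (_ + _).
by apply: eq_bigr => p _; rewrite !mulNr.
Qed.

HB.instance Definition _ :=
  GRing.isZmodClosed.Build A two_sided_ideal two_sided_ideal_zmod_closed.

End TwoSidedIdeal.

(* The library turns a quotient by an ideal into a ring only over commutative
   rings; here is A / (r) for an arbitrary ring or algebra A. *)
Definition quot_by (A : pzRingType) (r : A) : Type := {quot (two_sided_ideal r)}.

Section QuotientRing.
Variables (A : pzRingType) (r : A).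
Local Notation Q := (quot_by r).

HB.instance Definition _ := Choice.on Q.
HB.instance Definition _ := GRing.Zmodule.on Q.
HB.instance Definition _ : EqQuotient A (equiv (two_sided_ideal r)) Q :=
  EqQuotient.on Q.
HB.instance Definition _ := ZmodQuotient.on Q.

Definition quot_one : Q := lift_cst Q 1.
Definition quot_mul : Q -> Q -> Q := lift_op2 Q *%R.

Canonical pi_quot_one := PiConst quot_one.

Lemma pi_quot_mul : {morph \pi_Q : x y / x * y >-> quot_mul x y}.
Proof.
move=> x y; unlock quot_mul; apply/eqP; rewrite piE equivE.
rewrite -[_ * _](addrNK (x * repr (\pi_Q y))) -mulrBr -addrA -mulrBl rpredD //.
  by rewrite two_sided_idealMl // idealrDE opprK reprK.
by rewrite two_sided_idealMr // idealrDE opprK reprK.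
Qed.
Canonical pi_quot_mul_morph := PiMorph2 pi_quot_mul.

Lemma quot_mulA : associative quot_mul.
Proof. by move=> x y z; rewrite -[x]reprK -[y]reprK -[z]reprK !piE mulrA. Qed.

Lemma quot_mul1r : left_id quot_one quot_mul.
Proof. by move=> x; rewrite -[x]reprK !piE mul1r. Qed.

Lemma quot_mulr1 : right_id quot_one quot_mul.
Proof. by move=> x; rewrite -[x]reprK !piE mulr1. Qed.

Lemma quot_mulDl : left_distributive quot_mul +%R.
Proof.
by move=> x y z; rewrite -[x]reprK -[y]reprK -[z]reprK !piE mulrDl.
Qed.

Lemma quot_mulDr : right_distributive quot_mul +%R.
Proof.
by move=> x y z; rewrite -[x]reprK -[y]reprK -[z]reprK !piE mulrDr.
Qed.

HB.instance Definition _ := GRing.Zmodule_isPzRing.Build Q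
  quot_mulA quot_mul1r quot_mulr1 quot_mulDl quot_mulDr.

Definition quot_pi : A -> Q := \pi_Q.

Lemma quot_piP (u : Q) : exists x, u = quot_pi x.
Proof. by exists (repr u); rewrite /quot_pi reprK. Qed.

Lemma quot_pi_eq0 (x : A) : (quot_pi x == 0) = (x \in two_sided_ideal r).
Proof.
by rewrite /quot_pi -[0 : Q]/(zero (two_sided_ideal r)) piE equivE subr0.
Qed.

Lemma quot_pi_is_zmod_morphism : zmod_morphism quot_pi.
Proof. by move=> x y; rewrite /quot_pi !piE. Qed.

Lemma quot_pi_is_monoid_morphism : monoid_morphism quot_pi.
Proof. by rewrite /quot_pi; split=> [|x y]; rewrite !piE. Qed.

HB.instance Definition _ :=
  GRing.isZmodMorphism.Build A Q quot_pi quot_pi_is_zmod_morphism.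
HB.instance Definition _ :=
  GRing.isMonoidMorphism.Build A Q quot_pi quot_pi_is_monoid_morphism.

End QuotientRing.

Section QuotientModule.
Variables (K : pzRingType) (A : lalgType K) (r : A).
Local Notation Q := (quot_by r).

Lemma two_sided_idealZ (a : K) (u : A) :
  u \in two_sided_ideal r -> a *: u \in two_sided_ideal r.
Proof. by move=> ur; rewrite -[u]mul1r scalerAl two_sided_idealMl. Qed.

Definition quot_scale (a : K) : Q -> Q := lift_op1 Q ( *:%R a).

Lemma pi_quot_scale a : {morph \pi_Q : x / a *: x >-> quot_scale a x}.
Proof.
move=> x; unlock quot_scale; apply/eqP; rewrite piE equivE.
by rewrite -scalerBr two_sided_idealZ // idealrBE reprK.
Qed.
Canonical pi_quot_scale_morph a := PiMorph1 (pi_quot_scale a).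

Lemma quot_scaleA a b (v : Q) :
  quot_scale a (quot_scale b v) = quot_scale (a * b) v.
Proof. by rewrite -[v]reprK !piE scalerA. Qed.

Lemma quot_scale1 : left_id 1 quot_scale.
Proof. by move=> v; rewrite -[v]reprK !piE scale1r. Qed.

Lemma quot_scaleDr : right_distributive quot_scale +%R.
Proof. by move=> a u v; rewrite -[u]reprK -[v]reprK !piE scalerDr. Qed.

Lemma quot_scaleDl v : {morph quot_scale^~ v : a b / a + b}.
Proof. by move=> a b; rewrite -[v]reprK !piE scalerDl. Qed.

HB.instance Definition _ := GRing.Zmodule_isLmodule.Build K Q
  quot_scaleA quot_scale1 quot_scaleDr quot_scaleDl.

Lemma quot_scaleAl (a : K) (u v : Q) : a *: (u * v) = (a *: u) * v.
Proof.
rewrite -[LHS]/(quot_scale a (quot_mul u v)) -[RHS]/(quot_mul (quot_scale a u) v).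
by rewrite -[u]reprK -[v]reprK !piE scalerAl.
Qed.

Lemma quot_pi_is_scalable : scalable (quot_pi r : A -> Q).
Proof. exact: pi_quot_scale. Qed.

HB.instance Definition _ :=
  GRing.isScalable.Build K A Q *:%R (quot_pi r) quot_pi_is_scalable.

End QuotientModule.

Lemma quot_scaleAr (K : pzRingType) (A : algType K) (r : A) (a : K)
  (u v : quot_by r) : a *: (u * v) = u * (a *: v).
Proof.
rewrite -[LHS]/(quot_scale a (quot_mul u v)) -[RHS]/(quot_mul u (quot_scale a v)).
by rewrite -[u]reprK -[v]reprK !piE scalerAr.
Qed.

Lemma quot_nonzero1 (A B : nzRingType) (r : A) (f : {rmorphism A -> B}) :
  f r = 0 -> 1 != 0 :> quot_by r.
Proof.
move=> fr0; rewrite -(rmorph1 (quot_pi r)) quot_pi_eq0.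
apply/two_sided_idealP => -[s /(congr1 f)/eqP].
rewrite rmorph1 rmorph_sum big1 ?oner_eq0 // => p _.
by rewrite !rmorphM fr0 mulr0 mul0r.
Qed.

Section FreeAlgebra.
Variables (k : comNzRingType) (I : choiceType).

(* The monoid algebra of the free monoid: k<I>, the I-variables not commuting. *)
Definition free_algebra : Type := {malg k[{fmonom I}]}.

HB.instance Definition _ := GRing.Lalgebra.on free_algebra.

Definition free_var (i : I) : free_algebra := mkmalgU (fmu i) 1.

Lemma free_scaleAr (a : k) (u v : free_algebra) : a *: (u * v) = u * (a *: v).
Proof.
rewrite -!mul_malgC mulrA; suff -> : malgC a * u = u * malgC a by rewrite mulrA.
rewrite !malgM_def fgmulUg fgmulgU; apply: eq_bigr => m _.
by rewrite mulrC mul1m mulm1.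
Qed.

HB.instance Definition _ :=
  GRing.Lalgebra_isAlgebra.Build k free_algebra free_scaleAr.

End FreeAlgebra.

Definition jordan_rel_of (A : pzRingType) (x y : A) : A :=
  x * y - y * x - y ^+ 2.

Lemma rmorph_jordan_rel (A B : pzRingType) (f : {rmorphism A -> B}) (x y : A) :
  f (jordan_rel_of x y) = jordan_rel_of (f x) (f y).
Proof. by rewrite /jordan_rel_of !rmorphB rmorphXn !rmorphM. Qed.

Section JordanPlane.
Variable k : comNzRingType.

Definition free_x : free_algebra k 'I_2 := free_var k ord0.
Definition free_y : free_algebra k 'I_2 := free_var k ord_max.

Definition jordan_plane : Type := quot_by (jordan_rel_of free_x free_y).

HB.instance Definition _ := GRing.PzRing.on jordan_plane.
HB.instance Definition _ := GRing.Lmodule.on jordan_plane.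

(* The augmentation x, y |-> 0 shows that the ideal is proper. *)
Lemma jordan_plane_nonzero1 : 1 != 0 :> jordan_plane.
Proof.
pose eps : {rmorphism {malg k[{fmonom 'I_2}]} -> k} :=
  mcoeff (mone : {fmonom 'I_2}).
have eps_var i : eps (free_var k i) = 0.
  by rewrite /eps /= mcoeffU; case: eqP => // /(congr1 (@fdeg _));
    rewrite fdegU fdeg1.
apply: (@quot_nonzero1 _ _ _ eps).
rewrite (rmorph_jordan_rel eps) !eps_var /jordan_rel_of.
by rewrite !mulr0 expr0n !subr0.
Qed.

HB.instance Definition _ :=
  GRing.PzSemiRing_isNonZero.Build jordan_plane jordan_plane_nonzero1.
HB.instance Definition _ :=
  GRing.Lmodule_isLalgebra.Build k jordan_plane
    (@quot_scaleAl k _ (jordan_rel_of free_x free_y)).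
HB.instance Definition _ :=
  GRing.Lalgebra_isAlgebra.Build k jordan_plane
    (@quot_scaleAr k _ (jordan_rel_of free_x free_y)).

Definition jordan_x : jordan_plane := quot_pi _ free_x.
Definition jordan_y : jordan_plane := quot_pi _ free_y.

Lemma jordan_relE : jordan_rel_of jordan_x jordan_y = 0.
Proof.
rewrite -(rmorph_jordan_rel (quot_pi (jordan_rel_of free_x free_y))).
by apply/eqP; rewrite quot_pi_eq0 two_sided_ideal_gen.
Qed.

End JordanPlane.

(* Main.v *)
Require Import Defs.
From mathcomp Require Import all_boot all_algebra.
Import GRing.Theory.
Local Open Scope ring_scope.

(** Write [X] and [Y] for the images of [x] and [y].  The relation
    [X * Y - Y * X = Y ^+ 2] says that [ad X] acts on [Y] as the derivation
    [t ^+ 2 * d/dt] acts on [t], so that it sends [p(Y)] to [p'(Y) * Y ^+ 2]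
    for every polynomial [p] ([jordan_commutator_horner]).

    Hence an identity [p(Y) * Y ^+ a = 0] implies [p'(Y) * Y ^+ (a + 2) = 0]:
    a polynomial relation on [Y] can be differentiated, at the cost of a power
    of [Y].  In characteristic [0], differentiating a nonzero polynomial until
    only a nonzero constant is left yields [Y ^+ m = 0]
    ([jordan_algebraic_nilpotent]).  In finite dimension [Y] does satisfy such
    a relation, by the Cayley-Hamilton theorem. *)

Lemma jordan_commutator_horner {k : fieldType} {A : algType k} {x y : A}
    (p : {poly k}) :
  jordan_rel_of x y = 0 ->
  x * horner_alg y p - horner_alg y p * x = horner_alg y (p^`() * 'X^2).
Proof.
move=> /eqP; rewrite subr_eq0 => /eqP xy.
elim/poly_ind: p => [|p c IHp].
  by rewrite deriv0 !mul0r !rmorph0 mulr0 mul0r subr0.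
have -> : (p * 'X + c%:P)^`() * 'X^2 = p^`() * 'X^2 * 'X + p * 'X^2.
  by rewrite derivMXaddC mulrDl addrC mulrAC.
rewrite !rmorphD !(rmorphM _ _ 'X) (rmorphM _ p) /= rmorphXn /=.
rewrite horner_algX horner_algC -IHp -xy.
rewrite mulrDr mulrDl -scalerAr -scalerAl mulr1 mul1r opprD addrACA subrr addr0.
by rewrite mulrBl mulrBr !mulrA addrA subrK.
Qed.

Lemma deriv_neq0 {k : fieldType} (p : {poly k}) :
  [pchar k] =i pred0 -> (1 < size p)%N -> p^`() != 0.
Proof.
move=> /pcharf0P char0 p_gt1; apply/eqP => /polyP/(_ (size p).-2).
rewrite coef_deriv coef0 -mulr_natr => /eqP.
rewrite prednK; last by case: (size p) p_gt1 => [|[]].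
rewrite mulf_eq0 char0 -lead_coefE lead_coef_eq0 -size_poly_eq0.
by case: (size p) p_gt1 => [|[]].
Qed.

(** Relations are differentiated in the form [p(y) * y ^+ a = 0]: applying
    [t ^+ 2 * d/dt] to [p * 'X^a] gives [p^`() * 'X^(a + 2)] up to a multiple
    of [p * 'X^a], so the degree of [p] drops and only the power of [y]
    grows. *)
Lemma jordan_algebraic_nilpotent {k : fieldType} {A : algType k} {x y : A}
    {p : {poly k}} :
    [pchar k] =i pred0 -> jordan_rel_of x y = 0 ->
    p != 0 -> horner_alg y p = 0 ->
  exists m : nat, y ^+ m = 0.
Proof.
move=> char0 xy; rewrite -[p in horner_alg y p]mulr1 -(expr0 'X).
have [s] := ubnP (size p).
elim: s p 0%N => // s IHs p a /ltnSE le_p_s p_neq0 py0.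
have [p_le1 | p_gt1] := leqP (size p) 1.
  exists a; move: py0 p_neq0; rewrite (size1_polyC p_le1) polyC_eq0.
  rewrite rmorphM rmorphXn /= horner_algX horner_algC -scalerAl mul1r.
  by move=> /eqP; rewrite scaler_eq0 => /orP[->|/eqP].
apply: (IHs p^`() a.+2).
- exact: leq_trans (lt_size_deriv p_neq0) le_p_s.
- exact: deriv_neq0.
have deriv_pXa : (p * 'X^a)^`() * 'X^2 = p^`() * 'X^(a.+2) + p * 'X^a * ('X *+ a).
  rewrite derivM mulrDl -!mulrA -exprD addn2 derivXn; congr (_ + p * _).
  case: a {py0} => [|a]; first by rewrite !mulr0n mul0r mulr0.
  by rewrite mulrnAl mulrnAr -exprD addn2 exprSr.
have := jordan_commutator_horner (p * 'X^a) xy.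
rewrite deriv_pXa rmorphD (rmorphM _ (p * _)) /= py0.
by rewrite !(mulr0, mul0r) subr0 addr0.
Qed.

Theorem lemma2p1 (k : closedFieldType) (pchar_k : [pchar k] =i pred0) (n : nat)
    (rho : {lrmorphism jordan_plane k -> 'M[k]_n}) :
  exists m : nat, rho (jordan_y k) ^+ m = 0.
Proof.
have: jordan_rel_of (rho (jordan_x k)) (rho (jordan_y k)) = 0.
  by rewrite -rmorph_jordan_rel jordan_relE rmorph0.
move: (rho (jordan_x k)) (rho (jordan_y k)) => X Y.
case: n {rho} X Y => [|n] X Y XY; first by exists 0%N; apply: thinmx0.
apply: (jordan_algebraic_nilpotent (p := char_poly Y) pchar_k XY).
  exact/monic_neq0/char_poly_monic.
rewrite -[RHS](Cayley_Hamilton Y); congr _.[_].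
by apply: eq_map_poly => c; rewrite /= scalemx1.
Qed.
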